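(* Let $\Gamma=(V,E)$ be a directed graph. If $\Gamma$ has a strong directed trail decomposition, then $\Gamma$ is a strongly connected directed graph.
   Context: A directed trail $P$ in a directed graph $\Gamma=(V,E)$ is a non-empty finite sequence of distinct directed edges $e_1,\dots,e_m$ with $\mathrm{tail}(e_{i+1})=\mathrm{head}(e_i)$ for $i=1,\dots,m-1$. Its start is $s(P)=\mathrm{tail}(e_1)$ and its terminus is $t(P)=\mathrm{head}(e_m)$. $V[P]$ denotes the set of vertices that are the head or tail of an edge of $P$. A directed trail decomposition of $\Gamma$ is a finite sequence of directed trails $(P_0,\dots,P_n)$ such that: (1) the edge sets of $P_0,\dots,P_n$ are pairwise disjoint and their union is $E$; (2) $s(P_0)=t(P_0)$; (3) for each $i=1,\dots,n$, if $V[P_i]\cap\bigcup_{j=0}^{i-1}V[P_j]$ is non-empty then it equals $\{s(P_i),t(P_i)\}$, and if it is empty then $s(P_i)=t(P_i)$. The decomposition is strong if $V[P_i]\cap\bigcup_{j=0}^{i-1}V[P_j]\neq\emptyset$ for every $i\in\{1,\dots,n\}$. $\Gamma$ is strongly connected if for all $u,v\in V$ either $u=v$, or there are a directed trail from $u$ to $v$ and a directed trail from $v$ to $u$.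
   Formalization: It is assumed that every vertex is the head or tail of some edge (otherwise false: V={a,b,c}, E={ab,ba}, P_0=(ab,ba)); vertices and edges are taken to have decidable equality, which excluded middle supplies. *)

(* Defs.v *)
From HB Require Import structures.
From mathcomp Require Import all_boot.

Set Implicit Arguments.
Unset Strict Implicit.
Unset Printing Implicit Defensive.

(* Loops and parallel edges are allowed, and nothing is assumed finite; a graph
   with edge set inside V * V is the case where [edge] is a subtype of pairs. *)
Record digraph := Digraph {
  vertex : eqType;
  edge : eqType;
  etail : edge -> vertex;
  ehead : edge -> vertex
}.

Arguments etail {d} e.
Arguments ehead {d} e.

(* A trail decomposition constrains only the edges, so an isolated vertex could
   never be detected by one. *)
Definition no_isolated_vertex (G : digraph) : Prop :=
  forall v : vertex G, exists e : edge G, v = etail e \/ v = ehead e.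

Definition consecutive (G : digraph) : rel (edge G) :=
  fun e f => etail f == ehead e.

(* The first edge is kept apart from the rest, so that trails are non-empty. *)
Record dtrail (G : digraph) := DTrail {
  first_edge : edge G;
  other_edges : seq (edge G);
  _ : uniq (first_edge :: other_edges);
  _ : path (@consecutive G) first_edge other_edges
}.

Section Trails.
Variable G : digraph.
Implicit Type p : dtrail G.

Definition edges p : seq (edge G) := first_edge p :: other_edges p.

Definition start p : vertex G := etail (first_edge p).

Definition terminus p : vertex G := ehead (last (first_edge p) (other_edges p)).

Definition vertices p : seq (vertex G) :=
  [seq etail e | e <- edges p] ++ [seq ehead e | e <- edges p].

Definition strongly_connected : Prop :=
  forall u v : vertex G,
    u = v \/
    (exists p, start p = u /\ terminus p = v) /\
    (exists q, start q = v /\ terminus q = u).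

Variables (n : nat) (P : 'I_n.+1 -> dtrail G).

Definition earlier_vertices (i : 'I_n.+1) : pred (vertex G) :=
  fun v => [exists j : 'I_n.+1, (j < i) && (v \in vertices (P j))].

Definition attached (i : 'I_n.+1) : Prop :=
  exists v, v \in [predI vertices (P i) & earlier_vertices i].

Definition trail_decomposition : Prop :=
  [/\ forall i j : 'I_n.+1, i != j ->
        forall e, ~ (e \in edges (P i) /\ e \in edges (P j)),
      forall e : edge G, exists i : 'I_n.+1, e \in edges (P i),
      start (P ord0) = terminus (P ord0)
    & forall i : 'I_n.+1, 0 < i ->
        (attached i ->
           [predI vertices (P i) & earlier_vertices i]
             =i [:: start (P i); terminus (P i)]) /\
        (~ attached i -> start (P i) = terminus (P i))].

Definition strong_trail_decomposition : Prop :=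
  trail_decomposition /\ forall i : 'I_n.+1, 0 < i -> attached i.

End Trails.

(* Main.v *)
(* A trail P_i of a strong decomposition starts and ends at vertices of earlier
   trails, so each of its vertices can reach, and be reached from, a vertex of
   an earlier trail. By induction on i, starting with the closed trail P_0, the
   vertices of P_0, ..., P_i are mutually reachable. Walks may be used instead
   of trails throughout, since deleting loops turns a walk into a trail. *)
Require Import Defs.
From HB Require Import structures.
From mathcomp Require Import all_boot.

Set Implicit Arguments.
Unset Strict Implicit.
Unset Printing Implicit Defensive.

(** Trails are non-empty, so [u = v] is a separate disjunct; it makes the relation reflexive. *)
Definition reach (G : digraph) (u v : vertex G) : Prop :=
  u = v \/ exists p : dtrail G, start p = u /\ terminus p = v.

(** Cutting out the stretch between two occurrences of an edge keeps the first and last edges. *)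
Lemma reach_walk (G : digraph) (e : edge G) (s : seq (edge G)) :
  path (@consecutive G) e s -> reach (etail e) (ehead (last e s)).
Proof. by case/shortenP=> s' path_s' uniq_s' _; right; exists (DTrail uniq_s' path_s'). Qed.

Lemma reach_trans (G : digraph) (u v w : vertex G) :
  reach u v -> reach v w -> reach u w.
Proof.
case=> [-> // | [[e s us ps] [<- <-]]].
case=> [<- | [[f t ut pt] [eq_f <-]]]; first exact: reach_walk.
rewrite /start /terminus /= in eq_f *.
(* The two trails may share edges, so their concatenation is only a walk. *)
have := @reach_walk G e (s ++ f :: t).
rewrite last_cat /=; apply.
by rewrite cat_path ps /= pt andbT /consecutive eq_f.
Qed.

Lemma reach_edge (G : digraph) (e : edge G) : reach (etail e) (ehead e).
Proof. exact: (@reach_walk G e [::]). Qed.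

(** Both conclusions stop short of [e] itself: adding [e] to one of them handles its head or its
    tail. *)
Lemma path_reach (G : digraph) (e0 : edge G) (s : seq (edge G)) (e : edge G) :
  path (@consecutive G) e0 s -> e \in e0 :: s ->
  reach (etail e0) (etail e) /\ reach (ehead e) (ehead (last e0 s)).
Proof.
elim: s e0 => [|f s IHs] e0 /=.
  by move=> _; rewrite mem_seq1 => /eqP->; split; left.
case/andP=> /eqP e0f pfs; rewrite inE => /predU1P[-> | /(IHs _ pfs)[fe el]].
  by split; [left | rewrite -e0f; exact: reach_walk].
by split=> //; apply: reach_trans (reach_edge e0) _; rewrite -e0f.
Qed.

Lemma trail_reach (G : digraph) (p : dtrail G) (x : vertex G) :
  x \in vertices p -> reach (start p) x /\ reach x (terminus p).
Proof.
case: p => e0 s us ps.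
rewrite mem_cat => /orP[] /mapP[e /(path_reach ps)[se et] ->]; split=> //.
  exact: reach_trans (reach_edge e) et.
exact: reach_trans se (reach_edge e).
Qed.

(** The bound [m] serves for the induction; as [i] and [j] are not ordered, the hypothesis gives
    reachability both ways. *)
Lemma strong_decomposition_reach (G : digraph) (n : nat)
    (P : 'I_n.+1 -> dtrail G) (m : nat) (i j : 'I_n.+1) (x y : vertex G) :
  strong_trail_decomposition P -> i <= m -> j <= m ->
  x \in vertices (P i) -> y \in vertices (P j) -> reach x y.
Proof.
case=> -[_ _ closed0 ends] strong.
elim: m i j x y => [|m IHm] i j x y.
  rewrite !leqn0 => /eqP i0 /eqP j0.
  have -> : i = ord0 by apply: val_inj.
  have -> : j = ord0 by apply: val_inj.
  move=> /trail_reach[_ xt] /trail_reach[sy _].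
  by apply: reach_trans xt _; rewrite -closed0.
have earlier (k : 'I_n.+1) (z : vertex G) : k <= m.+1 -> z \in vertices (P k) ->
    (exists (l : 'I_n.+1) (a : vertex G),
       [/\ l <= m, a \in vertices (P l) & reach z a]) /\
    (exists (l : 'I_n.+1) (b : vertex G),
       [/\ l <= m, b \in vertices (P l) & reach b z]).
  rewrite leq_eqVlt => /predU1P[km | ltkm] zk; last first.
    by split; exists k, z; split=> //; left.
  have k0 : 0 < k by rewrite km.
  have endsE := (ends k k0).1 (strong k k0).
  have [sz zt] := trail_reach zk.
  (* Read from right to left at the two ends of [P k], [endsE] places each of them on an earlier
     trail. *)
  have [] := (endsE (terminus (P k)), endsE (start (P k))).
  rewrite !inE !eqxx orbT.
  move=> /andP[_ /existsP[l /andP[lk tl]]] /andP[_ /existsP[l' /andP[lk' sl]]].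
  by split; [exists l, (terminus (P k)) | exists l', (start (P k))];
     split=> //; rewrite -ltnS -km.
move=> im jm /(earlier _ _ im)[[l [a [lm al xa]]] _].
move=> /(earlier _ _ jm)[_ [l' [b [lm' bl by_]]]].
exact: reach_trans xa (reach_trans (IHm _ _ _ _ lm lm' al bl) by_).
Qed.

Theorem lemma3p1 (G : digraph) (hG : no_isolated_vertex G) :
  (exists (n : nat) (P : 'I_n.+1 -> dtrail G), strong_trail_decomposition P) ->
  strongly_connected G.
Proof.
case=> n [P decP].
(* Each vertex is an end of some edge, and each edge lies on some trail. *)
have covered (v : vertex G) : exists i : 'I_n.+1, v \in vertices (P i).
  have [e ve] := hG v; have [[_ coverE _ _] _] := decP.
  have [i ei] := coverE e; exists i; rewrite mem_cat.
  by case: ve => ->; rewrite map_f ?orbT.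
have reachG (u v : vertex G) : reach u v.
  have [[i ui] [j vj]] := (covered u, covered v).
  by apply: strong_decomposition_reach decP _ _ ui vj; rewrite -ltnS.
move=> u v; have [-> | puv] := reachG u v; first by left.
by have [-> | pvu] := reachG v u; [left | right].
Qed.
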